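(* Let $\mathscr{F}_1$ and $\mathscr{F}_2$ be $\omega$-closed families of nonempty inductive subsets of $\omega$. Then the following conditions are equivalent: (1) the semigroups $\boldsymbol{B}_{\omega}^{\mathscr{F}_1}$ and $\boldsymbol{B}_{\omega}^{\mathscr{F}_2}$ are isomorphic; (2) the families $\mathscr{F}_1$ and $\mathscr{F}_2$ have the same cardinality; (3) there exists an integer $n$ such that $\mathscr{F}_1=\{n+F\colon F\in\mathscr{F}_2\}$.
   Context: $\omega$ is the set of nonnegative integers. A subset $A\subseteq\omega$ is inductive if $i\in A$ implies $i+1\in A$. For an integer $n$ and $F\subseteq\omega$ put $n+F=\{n+k\colon k\in F\}$ (a subset of $\mathbb{Z}$). A nonempty family $\mathscr{F}\subseteq\mathscr{P}(\omega)$ is $\omega$-closed if $F_1\cap(-n+F_2)\in\mathscr{F}$ for all $n\in\omega$ and $F_1,F_2\in\mathscr{F}$. For an $\omega$-closed family $\mathscr{F}$ with $\varnothing\notin\mathscr{F}$, $\boldsymbol{B}_{\omega}^{\mathscr{F}}$ is the set of triples $(i,j,F)$ with $i,j\in\omega$, $F\in\mathscr{F}$, with the (associative) operation $$(i_1,j_1,F_1)\cdot(i_2,j_2,F_2)=\begin{cases}(i_1-j_1+i_2,\,j_2,\,(j_1-i_2+F_1)\cap F_2), & j_1<i_2;\\ (i_1,\,j_2,\,F_1\cap F_2), & j_1=i_2;\\ (i_1,\,j_1-i_2+j_2,\,F_1\cap(i_2-j_1+F_2)), & j_1>i_2.\end{cases}$$ *)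

(* Defs.v *)
From HB Require Import structures.
From mathcomp Require Import all_boot all_order all_algebra.
From mathcomp Require Import zify.
From mathcomp Require Import boolp classical_sets functions cardinality.

Set Implicit Arguments.
Unset Strict Implicit.
Unset Printing Implicit Defensive.

Import Order.TTheory GRing.Theory Num.Theory.

Local Open Scope classical_set_scope.

Definition inductive_subset (A : set nat) : Prop := forall i, A i -> A i.+1.

(* n + A, as a subset of the integers: the translate of a set of naturals by a
   negative integer may leave the naturals. *)
Definition translate (n : int) (A : set nat) : set int :=
  [set (n + k%:Z)%R | k in A].

(* The intersection of a set of integers with the naturals. *)
Definition nat_part (X : set int) : set nat := Posz @^-1` X.

(* The operations below only use intersections of the form A `&` (n + B) with
   A a set of naturals, for which replacing n + B by its natural part is
   harmless. *)
Definition omega_closed (F : set (set nat)) : Prop :=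
  F !=set0 /\
  forall (n : nat) (A B : set nat), F A -> F B ->
    F (A `&` nat_part (translate (- n%:Z)%R B)).

(* The truncated subtractions of nat below are exact in the branches in which
   they occur. *)
Definition triple_mul (x y : nat * nat * set nat) : nat * nat * set nat :=
  let: (i1, j1, A1) := x in
  let: (i2, j2, A2) := y in
  if (j1 < i2)%N then
    ((i1 + i2 - j1)%N, j2, nat_part (translate (j1%:Z - i2%:Z)%R A1) `&` A2)
  else if j1 == i2 then
    (i1, j2, A1 `&` A2)
  else
    (i1, (j1 + j2 - i2)%N, A1 `&` nat_part (translate (i2%:Z - j1%:Z)%R A2)).

Definition triples (F : set (set nat)) : set (nat * nat * set nat) :=
  [set x | F x.2].

(* The carrier of B_omega^F. The product is well defined only for omega-closed
   F, so the type carries the proof. For F containing the empty set this is not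
   B_omega^F, which is then customarily a quotient of these triples. *)
Definition Bomega (F : set (set nat)) (hF : omega_closed F) : Type :=
  set_type (triples F).

Lemma nat_part_translateE (m n : nat) (A : set nat) (k : nat) : (m <= n)%N ->
  nat_part (translate (m%:Z - n%:Z)%R A) k = A (k + (n - m))%N.
Proof.
move=> mn; rewrite /nat_part /translate /=; apply/propext; split.
  move=> [l Al /= kl]; suff -> : (k + (n - m))%N = l by [].
  by lia.
by move=> Ak; exists (k + (n - m))%N => //; lia.
Qed.

Lemma triple_mulE (i1 j1 i2 j2 : nat) (A1 A2 : set nat) :
  triple_mul (i1, j1, A1) (i2, j2, A2) =
  ((i1 + (i2 - j1))%N, (j2 + (j1 - i2))%N,
   [set k | A1 (k + (i2 - j1))%N /\ A2 (k + (j1 - i2))%N]).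
Proof.
rewrite /triple_mul; case: ltngtP => [lt|lt|->].
- congr (_, _, _); [lia|lia|].
  apply/funext => k; rewrite /setI /mkset nat_part_translateE ?(ltnW lt) //.
  by have -> : (j1 - i2 = 0)%N by [lia]; rewrite addn0.
- congr (_, _, _); [lia|lia|].
  apply/funext => k; rewrite /setI /mkset nat_part_translateE ?(ltnW lt) //.
  by have -> : (i2 - j1 = 0)%N by [lia]; rewrite addn0.
- by rewrite subnn !addn0; congr (_, _, _); apply/funext => k; rewrite /mkset addn0.
Qed.

Lemma triple_mulA : associative triple_mul.
Proof.
move=> [[i1 j1] A1] [[i2 j2] A2] [[i3 j3] A3]; rewrite !triple_mulE.
congr (_, _, _); [lia|lia|]; apply/funext => k; rewrite /mkset.
rewrite -!addnA.
set a := (X in A1 (k + X)); set b := (X in A2 (k + X)).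
set c := (X in A3 (k + X)).
set a' := (X in _ = ((A1 (k + X) /\ _) /\ _)).
set b' := (X in _ = ((_ /\ A2 (k + X)) /\ _)).
set c' := (X in _ = (_ /\ A3 (k + X))).
have -> : a = a' by rewrite /a /a'; lia.
have -> : b = b' by rewrite /b /b'; lia.
have -> : c = c' by rewrite /c /c'; lia.
by apply/propext; tauto.
Qed.

Lemma triple_mul_closed (F : set (set nat)) (x y : nat * nat * set nat) :
  omega_closed F -> triples F x -> triples F y -> triples F (triple_mul x y).
Proof.
case: x y => [[i1 j1] A1] [[i2 j2] A2] [_ FI]; rewrite /triples /= => F1 F2.
case: ltngtP => [lt|lt|e] /=.
- rewrite setIC (_ : (j1%:Z - i2%:Z)%R = (- (i2 - j1)%N%:Z)%R); last by lia.
  exact: FI.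
- rewrite (_ : (i2%:Z - j1%:Z)%R = (- (j1 - i2)%N%:Z)%R); last by lia.
  exact: FI.
- suff -> : A2 = nat_part (translate (- 0%:Z)%R A2) by exact: FI.
  apply/funext => k; rewrite (_ : (- 0%:Z)%R = (0%:Z - 0%:Z)%R) //.
  by rewrite nat_part_translateE // addn0.
Qed.

Section BomegaSemigroup.
Variables (F : set (set nat)) (hF : omega_closed F).

HB.instance Definition _ := Choice.copy (Bomega hF) (set_type (triples F)).

Definition Bomega_mul (x y : Bomega hF) : Bomega hF :=
  SigSub (mem_set (triple_mul_closed hF (set_valP x) (set_valP y))).

Lemma Bomega_mulA : associative Bomega_mul.
Proof. by move=> x y z; apply: val_inj; rewrite /= triple_mulA. Qed.

HB.instance Definition _ := isSemigroup.Build (Bomega hF) Bomega_mulA.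

End BomegaSemigroup.

Definition isomorphic (S T : semigroupType) : Prop :=
  exists f : {multiplicative S -> T}, bijective f.

(* Main.v *)
Require Import Defs.
From HB Require Import structures.
From mathcomp Require Import all_boot all_order all_algebra.
From mathcomp Require Import zify.
From mathcomp Require Import boolp classical_sets functions cardinality.

Local Open Scope classical_set_scope.
Local Open Scope card_scope.

(** A nonempty inductive set is a ray [a, oo), so a family of such sets is a set
    of naturals a.  Intersecting with the translates allowed in an omega-closed
    family reaches every value between two of these naturals
    (inductive_family), so the family is an interval of rays: it is determined
    by its least element m and by its length, finite or infinite.  Since an
    initial segment of the naturals is determined by its cardinality
    (downclosed_card_sub), two equinumerous families differ only in m, that is,
    by a translation.

    Conversely, a translation of the family by n carries products to products
    while leaving the first two coordinates alone (shift_triple_mul), so it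
    gives an isomorphism of semigroups.

    The cardinality of the family can be read off from the semigroup.  The
    idempotents are the triples (i, i, A); call two of them x, y swappable when
    x = u v and y = v u for some u, v.  Idempotents with the same third
    coordinate are swappable (swap_idempotents), whereas (0, 0, A) and
    (0, 0, B) are swappable only if A = B (swap_top_idempotents).  As
    swappability is preserved by isomorphisms, sending A to the third
    coordinate of the image of (0, 0, A) is injective (card_le_of_iso).  In
    effect the Green D-classes are being counted, one for each member of the
    family. *)

(** * The cardinality of the family as an isomorphism invariant *)

Definition triple_elt {F : set (set nat)} (hF : omega_closed F) (i j : nat)
    {A : set nat} (FA : F A) : Bomega hF :=
  SigSub (mem_set (FA : triples F (i, j, A))).

Lemma Bomega_val_mul (F : set (set nat)) (hF : omega_closed F)
  (x y : Bomega hF) : val (x * y)%g = triple_mul (val x) (val y).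
Proof. by []. Qed.

Lemma idempotent_diagonal (F : set (set nat)) (hF : omega_closed F)
  (x : Bomega hF) : (x * x)%g = x -> (val x).1.1 = (val x).1.2.
Proof.
move=> /(congr1 val); rewrite Bomega_val_mul.
case: (val x) => [[p q] C]; rewrite triple_mulE /= => -[]; lia.
Qed.

(** The first two coordinates of the products being zero force those of x and y
    to be zero, and on such triples the product is the intersection of the
    third coordinates, which is commutative. *)
Lemma swap_top_idempotents (x y : nat * nat * set nat) (A B : set nat) :
  triple_mul x y = (0%N, 0%N, A) -> triple_mul y x = (0%N, 0%N, B) -> A = B.
Proof.
case: x y => [[i j] C] [[k l] D]; rewrite !triple_mulE.
move=> [i0 l0 <-] [k0 j0 <-].
have [-> -> -> ->] : [/\ i = 0, j = 0, k = 0 & l = 0]%N by split; lia.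
by apply/funext => n; apply/propext; rewrite /mkset /=; tauto.
Qed.

(** For (p, p, C) and (q, q, C) the factors are (p, q, C) and (q, p, C). *)
Lemma swap_idempotents (F : set (set nat)) (hF : omega_closed F)
    (x y : Bomega hF) :
  (x * x)%g = x -> (y * y)%g = y -> (val x).2 = (val y).2 ->
  exists u v : Bomega hF, (u * v)%g = x /\ (v * u)%g = y.
Proof.
move=> /idempotent_diagonal xx /idempotent_diagonal yy.
have : F (val x).2 := set_valP x.
case xE : (val x) xx => [[p p'] C]; case yE : (val y) yy => [[q q'] D] /=.
move=> qq' pp' FC CD; rewrite -{q'}qq' -{D}CD in yE; rewrite -{p'}pp' in xE.
exists (triple_elt hF p q FC), (triple_elt hF q p FC).
split; apply: val_inj; rewrite Bomega_val_mul ?xE ?yE triple_mulE;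
  by rewrite subnn !addn0; congr (_, _, _); apply/funext => k;
     apply/propext; rewrite /mkset addn0; tauto.
Qed.

Lemma bijective_multiplicative_inverse (S T : semigroupType)
    (f : {multiplicative S -> T}) :
  bijective f -> exists2 g : {multiplicative T -> S}, cancel f g & cancel g f.
Proof.
move=> [g fK gK].
have gM : {morph g : x y / (x * y)%g >-> (x * y)%g}.
  by move=> x y; apply: (can_inj fK); rewrite gmulfM !gK.
pose gm : {multiplicative T -> S} :=
  HB.pack g (isMultiplicative.Build _ _ g gM).
by exists gm.
Qed.

(** The third coordinate of the image of (0, 0, A) determines A: two such images
    with a common third coordinate are swappable idempotents, and applying g to
    the swapping factors makes the elements (0, 0, A) swappable as well. *)
Lemma card_le_of_iso (F G : set (set nat)) (hF : omega_closed F)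
    (hG : omega_closed G) (f : {multiplicative Bomega hF -> Bomega hG})
    (g : {multiplicative Bomega hG -> Bomega hF}) :
  cancel f g -> cancel g f -> F #<= G.
Proof.
move=> fK gK.
pose e (A : set_type F) := triple_elt hF 0 0 (set_valP A).
have ee A : (f (e A) * f (e A))%g = f (e A).
  rewrite -gmulfM; congr (f _); apply: val_inj.
  rewrite Bomega_val_mul triple_mulE; congr (_, _, _).
  by apply/funext => k; apply/propext; rewrite /mkset addn0; tauto.
pose s (A : set_type F) := (val (f (e A))).2.
have s_inj : injective s.
  move=> A B /(swap_idempotents _ _ _ _ (ee A) (ee B))[u [v [uv vu]]].
  apply: val_inj; apply: (swap_top_idempotents (val (g u)) (val (g v))).
    by rewrite -Bomega_val_mul -gmulfM uv fK.
  by rewrite -Bomega_val_mul -gmulfM vu fK.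
have sG : range s `<=` G by move=> _ [A _ <-]; exact: (set_valP (f (e A))).
have FT : [set: set_type F] #= F by exact: card_setT.
apply: card_le_trans (subset_card_le sG).
have sF : range s #= F.
  by apply: card_eq_trans FT; apply: inj_card_eq => x y _ _; exact: s_inj.
by move: sF; rewrite card_eq_le => /andP[].
Qed.

(** * Families of nonempty inductive sets *)

Definition tail (a : nat) : set nat := [set k | a <= k]%N.

Lemma inductive_tail (A : set nat) :
  A !=set0 -> inductive_subset A -> exists a, A = tail a.
Proof.
move=> [x0 Ax0] Aind.
have exA : exists n, `[< A n >] by exists x0; apply/asboolP.
have [a /asboolP Aa amin] := ex_minnP exA.
exists a; apply/funext => k; apply/propext; split; first by move=> /asboolP/amin.
rewrite /tail /mkset => /subnK <-.
by elim: (k - a)%N => [|d]; rewrite ?add0n // addSn; apply: Aind.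
Qed.

Lemma tail_inj : injective tail.
Proof.
move=> a b E; apply/eqP; rewrite eqn_leq.
have ab : tail a b by rewrite E; exact: leqnn.
have ba : tail b a by rewrite -E; exact: leqnn.
exact/andP.
Qed.

Definition downclosed (D : set nat) : Prop :=
  forall d e, (d <= e)%N -> D e -> D d.

(** With m the least endpoint, D consists of the d with m + d an endpoint.
    For d <= e, the ray from m + d is the intersection of the ray from m with
    the ray from m + e moved down by e - d, so d is in D as soon as e is. *)
Lemma inductive_family (F : set (set nat)) :
  omega_closed F -> (forall A, F A -> A !=set0 /\ inductive_subset A) ->
  exists m D, downclosed D /\ F = [set tail (m + d)%N | d in D].
Proof.
move=> [[A0 FA0] Fcap] Find.
have Ftail A : F A -> exists a, A = tail a.
  by move=> /Find[]; exact: inductive_tail.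
have exm : exists n, `[< F (tail n) >].
  by have [a Ea] := Ftail _ FA0; exists a; apply/asboolP; rewrite -Ea.
have [m /asboolP Fm mmin] := ex_minnP exm.
exists m, [set d | F (tail (m + d)%N)]; split.
  move=> d e de; rewrite /mkset => Fe.
  suff -> : tail (m + d)%N =
    tail m `&` nat_part (translate (- (e - d)%N%:Z)%R (tail (m + e)%N)).
    exact: Fcap.
  apply/funext => k; rewrite /setI /mkset.
  rewrite (_ : (- (e - d)%N%:Z)%R = (0%:Z - (e - d)%N%:Z)%R); last by lia.
  by rewrite nat_part_translateE // /tail /mkset; apply/propext; split; lia.
apply/seteqP; split => [A FA|_ [d Fd <-] //].
have [a Ea] := Ftail _ FA; rewrite Ea in FA *.
have ma : (m <= a)%N by apply: mmin; apply/asboolP.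
by exists (a - m)%N; rewrite /= subnKC.
Qed.

(** If e in E were missing from D, then D would have at most e elements and E at
    least e + 1. *)
Lemma downclosed_card_sub (D E : set nat) :
  downclosed D -> downclosed E -> E #<= D -> E `<=` D.
Proof.
move=> Ddc Edc ED e Ee; apply: contrapT => nDe.
have De : D `<=` `I_e.
  move=> d Dd; rewrite /mkset ltnNge; apply/negP => ed.
  by apply: nDe; exact: Ddc Dd.
have eE : `I_e.+1 `<=` E by move=> d de; exact: Edc Ee.
have := card_le_trans (subset_card_le eE) (card_le_trans ED (subset_card_le De)).
by rewrite card_le_II ltnn.
Qed.

Lemma card_tails (m : nat) (D : set nat) : [set tail (m + d)%N | d in D] #= D.
Proof. by apply: inj_card_eq => x y _ _ /tail_inj /addnI. Qed.

Lemma translate_tail (a b : nat) :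
  translate (a%:Z - b%:Z)%R (tail b) = Posz @` tail a.
Proof.
apply/seteqP; rewrite /translate /tail; split=> [_ [k /= bk <-]|_ [k /= ak <-]].
  by exists (k + a - b)%N; lia.
by exists (k + b - a)%N; lia.
Qed.

(** * Translating a family *)

(** Members of F are sets of naturals, so no element is lost when a member of G
    is moved and then moved back. *)
Lemma translate_family_sym (F G : set (set nat)) (n : int) :
  [set Posz @` A | A in F] = [set translate n A | A in G] ->
  [set Posz @` A | A in G] = [set translate (- n)%R A | A in F].
Proof.
move=> E.
have back A B : Posz @` A = translate n B -> translate (- n)%R A = Posz @` B.
  move=> AB; apply/seteqP; split=> [_ [k Ak <-]|_ [k Bk <-]].
    have : (Posz @` A) k by exists k.
    by rewrite AB => -[l Bl /= lk]; exists l => //; lia.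
  have : translate n B (n + k%:Z)%R by exists k.
  by rewrite -AB => -[l Al /= lk]; exists l => //; lia.
apply/seteqP; split=> [_ [B GB <-]|_ [A FA <-]].
  have : [set translate n A | A in G] (translate n B) by exists B.
  by rewrite -E => -[A FA /= AB]; exists A => //; exact: back.
have : [set Posz @` A | A in F] (Posz @` A) by exists A.
by rewrite E => -[B GB /= AB]; exists B => //; rewrite (back A B).
Qed.

Definition shift (n : int) (A : set nat) : set nat := nat_part (translate n A).

(** The translate of A by n is a member of F, hence has no negative element and
    taking its natural part is reversible. *)
Lemma shift_family (F G : set (set nat)) (n : int) (A : set nat) :
  [set Posz @` A | A in F] = [set translate n A | A in G] -> G A ->
  F (shift n A) /\ shift (- n)%R (shift n A) = A.
Proof.
move=> E GA.
have : [set translate n A | A in G] (translate n A) by exists A.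
rewrite -E => -[B FB /= BA].
have sB : shift n A = B.
  rewrite /shift -BA; apply/seteqP; split=> [k [l Bl /= [<-]] //|k Bk].
  by exists k.
rewrite sB; split=> //; apply/seteqP; split=> [k [l Bl /= lk]|k Ak].
  have : (Posz @` B) l by exists l.
  by rewrite BA => -[p Ap /= pl]; have -> : k = p by lia.
have : translate n A (n + k%:Z)%R by exists k.
by rewrite -BA => -[l Bl /= lk]; exists l => //; lia.
Qed.

Definition shift_triple (n : int) (x : nat * nat * set nat) :=
  (x.1, shift n x.2).

(** Elements may be lost when n is negative, consistently on both sides: in a
    product one of the two sets enters unshifted, and the elements lost from
    that set are lost from the intersection as well. *)
Lemma shift_triple_mul (n : int) (x y : nat * nat * set nat) :
  shift_triple n (triple_mul x y) =
  triple_mul (shift_triple n x) (shift_triple n y).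
Proof.
case: x y => [[i j] A] [[k l] B]; rewrite triple_mulE [RHS]triple_mulE.
congr (_, _, _); apply/seteqP; split=> [p [q [/= Aq Bq] /= qp]|p].
  by split; [exists (q + (k - j))%N|exists (q + (j - k))%N] => //=; lia.
move=> [[q Aq /= qp] [r Br /= rp]].
(* One of j - k and k - j is zero, so p - n is one of q, r, hence natural. *)
have [t tp] : exists t : nat, (n + t%:Z = p%:Z)%R.
  have [kj|jk] := leqP k j; [exists q|exists r]; lia.
exists t => //; split.
  by have -> : (t + (k - j) = q)%N by lia.
by have -> : (t + (j - k) = r)%N by lia.
Qed.

Lemma iso_of_translate (F G : set (set nat)) (hF : omega_closed F)
    (hG : omega_closed G) (n : int) :
  [set Posz @` A | A in F] = [set translate n A | A in G] ->
  isomorphic (Bomega hF) (Bomega hG).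
Proof.
move=> E; have E' := translate_family_sym _ _ _ E.
have toG (x : Bomega hF) : triples G (shift_triple (- n)%R (val x)).
  by have [] := shift_family _ _ _ _ E' (set_valP x).
have toF (y : Bomega hG) : triples F (shift_triple n (val y)).
  by have [] := shift_family _ _ _ _ E (set_valP y).
pose f x : Bomega hG := SigSub (mem_set (toG x)).
pose g y : Bomega hF := SigSub (mem_set (toF y)).
have fM : {morph f : x y / (x * y)%g >-> (x * y)%g}.
  by move=> x y; apply: val_inj; exact: shift_triple_mul.
pose fm : {multiplicative Bomega hF -> Bomega hG} :=
  HB.pack f (isMultiplicative.Build _ _ f fM).
exists fm, g => [x|y]; apply: val_inj; rewrite /= /shift_triple /=.
  have [_] := shift_family _ _ _ _ E' (set_valP x).
  by rewrite GRing.opprK => ->; rewrite -surjective_pairing.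
have [_ ->] := shift_family _ _ _ _ E (set_valP y).
by rewrite -surjective_pairing.
Qed.

Theorem mainTheorem3 (F1 F2 : set (set nat))
    (hF1 : omega_closed F1) (hF2 : omega_closed F2)
    (ind1 : forall A, F1 A -> A !=set0 /\ inductive_subset A)
    (ind2 : forall A, F2 A -> A !=set0 /\ inductive_subset A) :
  [<-> isomorphic (Bomega hF1) (Bomega hF2);
       F1 #= F2;
       exists n : int,
         [set Posz @` A | A in F1] = [set translate n A | A in F2]].
Proof.
tfae.
- move=> [f /bijective_multiplicative_inverse[g fK gK]].
  by apply: Cantor_Bernstein; [exact: (card_le_of_iso _ _ _ _ f g)
                              |exact: (card_le_of_iso _ _ _ _ g f)].
- have [m1 [D1 [D1dc ->]]] := inductive_family _ hF1 ind1.
  have [m2 [D2 [D2dc ->]]] := inductive_family _ hF2 ind2.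
  move=> E12.
  have : D1 #= D2.
    apply: card_eq_trans (card_eq_trans E12 (card_tails m2 D2)).
    exact: card_esym (card_tails m1 D1).
  rewrite card_eq_le => /andP[D12 D21].
  have -> : D1 = D2 by apply/seteqP; split; exact: downclosed_card_sub.
  exists (m1%:Z - m2%:Z)%R; rewrite !image_comp.
  apply: eq_imagel => d _ /=; rewrite -(translate_tail _ (m2 + d)%N); congr translate; lia.
- by move=> [n]; exact: iso_of_translate.
Qed.
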